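(* Let $\Bbbk$ be a commutative ring with unit and let $X$ be a $1$-reduced simplicial set (that is, $X$ has exactly one vertex $x_0$, and its only $1$-simplex is $s_0(x_0)$). Then the chain complex $C_*(\mathbf{\Lambda}X)$ of the closed necklical set $\mathbf{\Lambda}X$ coincides with the coHochschild complex $\Lambda C_*(X)$ of the differential graded coalgebra $C_*(X)$.
   Context: Faces and degeneracies of $X$ are $\partial_i,s_j$. All modules are over $\Bbbk$. $C_*(X)$ is the simplicial chain complex of $X$ ($C_n(X)$ is the free module on the $n$-simplices of $X$, with $d_C=\sum_i(-1)^i\partial_i$), a dg coalgebra with the Alexander–Whitney coproduct $\Delta(\sigma)=\sum_{i=0}^{n}\partial_{i+1}\cdots\partial_n\sigma\otimes\partial_0\cdots\partial_{i-1}\sigma$ for $\sigma\in X_n$, coaugmented by $x_0$. **coHochschild complex.** For a coaugmented dg coassociative coalgebra $(C,d_C,\Delta,\epsilon)$, free over $\Bbbk$ in each degree, let $\overline C=\mathrm{coker}(\epsilon:\Bbbk\to C)$. The cobar construction $\Omega C$ is the tensor algebra on $s^{-1}\overline C$, with $s^{-1}\bar c_1\otimes\cdots\otimes s^{-1}\bar c_n$ written $[\bar c_1|\dots|\bar c_n]$, and with differential the derivation extending $d_{\Omega C}[\bar c]=-[\overline{d_C(c)}]+\sum(-1)^{|c'|}[\bar c'|\bar c'']$, where $\Delta(\bar c)=\sum\bar c'\otimes\bar c''$ is the induced coproduct on $\overline C$. The coHochschild complex is $\Lambda C=(C\otimes\Omega C,\ d_C\otimes1+1\otimes d_{\Omega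 C}+\theta_1+\theta_2)$ with $$\theta_1(v\otimes[\bar c_1|\dots|\bar c_n])=-\sum(-1)^{|v'|}v'\otimes[\bar v''|\bar c_1|\dots|\bar c_n],$$ $$\theta_2(v\otimes[\bar c_1|\dots|\bar c_n])=\sum(-1)^{(|v'|+1)(|v''|+\epsilon^c_n)}v''\otimes[\bar c_1|\dots|\bar c_n|\bar v'],\qquad \epsilon^c_n=|c_1|+\dots+|c_n|+n,$$ where $\Delta v=\sum v'\otimes v''$. **The closed necklical set $\mathbf{\Lambda}X$ for $1$-reduced $X$.** Words $y=\bar\sigma_1\cdots\bar\sigma_k$, $k\ge1$, are formed from simplices $\sigma_i\in X$ of dimension $m_i\ge1$; the degree of $y$ is $r=\sum_i(m_i-1)$. Words are taken modulo the relations $\bar\sigma_1\cdots\overline{s_{m_i}(\sigma_i)}\cdot\bar\sigma_{i+1}\cdots\bar\sigma_k=\bar\sigma_1\cdots\bar\sigma_i\cdot\overline{s_0(\sigma_{i+1})}\cdots\bar\sigma_k$ ($1\le i\le k-1$), and $e=\overline{s_0(x_0)}$ is a unit for concatenation. The resulting graded set of words is denoted $\mathbf{\Omega}X$. A word has face operators $d^\epsilon_j$ ($\epsilon=0,1$; $1\le j\le r$) listed by going through the letters in order and, within the letter $\sigma_i$, through $l=1,\dots,m_i-1$: $d^1$ replaces $\bar\sigma_i$ by $\overline{\partial_l\sigma_i}$, and $d^0$ replaces $\bar\sigma_i$ by $\overline{\partial_{l+1}\cdots\partial_{m_i}\sigma_i}\cdot\overline{\partial_0\cdots\partial_{l-1}\sigma_i}$.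 Degeneracies $\eta_j$ of words replace a letter $\sigma_i$ by some $s_l\sigma_i$; in particular $\eta_1(y)=\overline{s_0\sigma_1}\,\bar\sigma_2\cdots\bar\sigma_k$. The set $\mathbf{\Lambda}_{n_0,r}X$ consists of (classes of) pairs $(x,y)$ with $x\in X_{n_0}$ and $y$ a word of degree $r$, modulo $(s_{n_0}(x),y)\sim(x,\eta_1(y))$. Put $n=n_0+r$. The face operators are: - $d^0_1(x,y)=(x_0,\bar x\cdot y)$ if $n_0\ge1$; $d^0_i(x,y)=(\partial_i\cdots\partial_{n_0}(x),\overline{\partial_0\cdots\partial_{i-2}(x)}\cdot y)$ for $2\le i\le n_0$; $d^0_i(x,y)=(x,d^0_{i-n_0}y)$ for $n_0<i\le n$; - $d^1_i(x,y)=(\partial_{i-1}(x),y)$ for $2\le i\le n_0$; $d^1_i(x,y)=(x,d^1_{i-n_0}y)$ for $n_0<i\le n$; - $d^2_i(x,y)=(\partial_0\cdots\partial_{i-1}(x),y\cdot\overline{\partial_{i+1}\cdots\partial_{n_0}(x)})$ for $1\le i\le n_0$; and $d^1_1:=d^2_1$ if $n_0\ge1$. Degeneracies on pairs are $(x,y)\mapsto(s_jx,y)$ and $(x,y)\mapsto(x,\eta_jy)$. The set $\mathbf{\Omega}X$ is regarded as a subset of $\mathbf{\Lambda}X$ via $y\mapsto(x_0,y)$. **Chain complex of $\mathbf{\Lambda}X$.** $C_*(\mathbf{\Lambda}X)=C'_*(\mathbf{\Lambda}X)/C'_*(D(e))$, where $C'_*(\mathbf{\Lambda}X)$ is the free $\Bbbk$-module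 generated by the set $\mathbf{\Lambda}X$ (with $(x,y)\in\mathbf{\Lambda}_{n_0,r}X$ in degree $n=n_0+r$), $D(e)\subset\mathbf{\Omega}X\subset\mathbf{\Lambda}X$ is the set of degeneracies arising from the unit $e\in\mathbf{\Omega}X$, and $C'_*(D(e))$ is the submodule generated by $D(e)$. The differential acts on the component of $\mathbf{\Lambda}_{n_0,r}X$ by $$d_{n_0,r}=\sum_{i=1}^{n}(-1)^i(d^0_i-d^1_i)+\sum_{i=2}^{n_0}(-1)^{(i-1)n}d^2_i .$$
   Formalization: C_*(X) is taken as normalized chains (degenerate simplices are zero), and C_*(ΛX) is divided by all degenerate pairs rather than only D(e); without this the complexes differ, already for X a point. *)

(* Defs.v *)
From Stdlib Require Import Relations.
From HB Require Import structures.
From mathcomp Require Import all_boot all_order all_algebra finmap generic_quotient.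
From mathcomp Require Import boolp.
From mathcomp.multinomials Require Import monalg.

Set Implicit Arguments.
Unset Strict Implicit.
Unset Printing Implicit Defensive.

Import GRing.Theory.

(** * Simplicial sets *)

(* The graded set X = \coprod_n X_n is a single type with a dimension function.
   [face i x] and [degen j x] are only meaningful (and only constrained) for
   i <= dim x, 0 < dim x and for j <= dim x; no definition below uses them
   outside these ranges. *)
Record sset := SSet {
  simplex :> choiceType;
  dim : simplex -> nat;
  face : nat -> simplex -> simplex;
  degen : nat -> simplex -> simplex;
  dim_face : forall i x, 0 < dim x -> i <= dim x -> dim (face i x) = (dim x).-1;
  dim_degen : forall j x, j <= dim x -> dim (degen j x) = (dim x).+1;
  face_face : forall i j x, 1 < dim x -> i < j -> j <= dim x ->
    face i (face j x) = face j.-1 (face i x);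
  face_degen_lt : forall i j x, i < j -> j <= dim x ->
    face i (degen j x) = degen j.-1 (face i x);
  face_degen_id : forall j x, j <= dim x -> face j (degen j x) = x;
  face_degen_idS : forall j x, j <= dim x -> face j.+1 (degen j x) = x;
  face_degen_gt : forall i j x, j.+1 < i -> i <= (dim x).+1 ->
    face i (degen j x) = degen j (face i.-1 x);
  degen_degen : forall i j x, i <= j -> j <= dim x ->
    degen i (degen j x) = degen j.+1 (degen i x)
}.

Definition degenerate (X : sset) (x : X) : Prop :=
  exists j y, j <= dim y /\ x = degen j y.

Record reduced_sset := ReducedSSet {
  reduced_sort :> sset;
  pt : reduced_sort;
  dim_pt : dim pt = 0;
  vertex_uniq : forall x : reduced_sort, dim x = 0 -> x = pt;
  edge_uniq : forall x : reduced_sort, dim x = 1 -> x = degen 0 pt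
}.
Arguments pt {r}.

(* [front i x] is the face of x on the vertices 0, ..., i and [back i x] the
   face on the vertices i, ..., dim x. *)
Definition front (X : sset) (i : nat) (x : X) : X :=
  foldr (@face X) x (iota i.+1 (dim x - i)).
Definition back (X : sset) (i : nat) (x : X) : X :=
  foldr (@face X) x (iota 0 i).

(** * The closed necklical set of a 1-reduced simplicial set *)

Section Necklical.
Variable X : reduced_sset.

Definition letter := {s : X | 0 < dim s}.
HB.instance Definition _ := [isSub of letter for @sval X (fun s => 0 < dim s)].
HB.instance Definition _ := [Choice of letter by <:].

Fact unit_subproof : 0 < dim (degen 0 (@pt X)).
Proof. by rewrite dim_degen. Qed.
Definition unit_letter : letter := exist _ (degen 0 pt) unit_subproof.

(* The letter of a simplex of positive dimension; only used on such. *)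
Definition ltr (s : X) : letter := insubd unit_letter s.

(* The empty word is allowed as a representative of the unit. *)
Definition word := seq letter.

Inductive word_step : word -> word -> Prop :=
| WordSlide u (s t : letter) v :
    word_step (u ++ ltr (degen (dim (val s)) (val s)) :: t :: v)
              (u ++ s :: ltr (degen 0 (val t)) :: v)
| WordUnit u v : word_step (u ++ unit_letter :: v) (u ++ v).

Definition precell := (X * word)%type.

(* In CellSlide the word is s :: w and eta_1 (s :: w) is the word on the right. *)
Inductive cell_step : precell -> precell -> Prop :=
| CellWord x w w' : word_step w w' -> cell_step (x, w) (x, w')
| CellSlide x (s : letter) w :
    cell_step (degen (dim x) x, s :: w) (x, ltr (degen 0 (val s)) :: w).

Definition cell_eq (c c' : precell) : bool :=
  `[< clos_refl_sym_trans precell cell_step c c' >].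

Fact cell_eq_refl : reflexive cell_eq.
Proof. by move=> c; apply/asboolP/rst_refl. Qed.
Fact cell_eq_sym : symmetric cell_eq.
Proof. by move=> c c'; apply/asboolP/asboolP; apply: rst_sym. Qed.
Fact cell_eq_trans : transitive cell_eq.
Proof.
by move=> b a c /asboolP ab /asboolP bc; apply/asboolP; apply: rst_trans ab bc.
Qed.
Canonical cell_equiv := EquivRel cell_eq cell_eq_refl cell_eq_sym cell_eq_trans.

Definition cell := {eq_quot cell_equiv}%qT.
HB.instance Definition _ := Choice.on cell.
HB.instance Definition _ := EqQuotient.on cell.

Definition cls (c : precell) : cell := \pi_cell%qT c.

Definition word_deg (w : word) : nat := \sum_(s <- w) (dim (val s)).-1.
Definition predeg (c : precell) : nat := dim c.1 + word_deg c.2.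
Definition cell_deg (c : cell) : nat := predeg (repr c).

Fixpoint wface0 (j : nat) (w : word) : word :=
  if w is s :: w' then
    if j < dim (val s) then ltr (front j (val s)) :: ltr (back j (val s)) :: w'
    else s :: wface0 (j - (dim (val s)).-1) w'
  else [::].

Fixpoint wface1 (j : nat) (w : word) : word :=
  if w is s :: w' then
    if j < dim (val s) then ltr (face j (val s)) :: w'
    else s :: wface1 (j - (dim (val s)).-1) w'
  else [::].

Definition cface0 (i : nat) (c : precell) : precell :=
  let: (x, w) := c in
  if dim x < i then (x, wface0 (i - dim x) w)
  else if i == 1 then (pt, ltr x :: w)
  else (front i.-1 x, ltr (back i.-1 x) :: w).

Definition cface2 (i : nat) (c : precell) : precell :=
  let: (x, w) := c in (back i x, rcons w (ltr (front i x))).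

Definition cface1 (i : nat) (c : precell) : precell :=
  let: (x, w) := c in
  if dim x < i then (x, wface1 (i - dim x) w)
  else if i == 1 then cface2 1 c
  else (face i.-1 x, w).

(* A letter has positive dimension, so the unit letter is not degenerate here. *)
Inductive predegenerate : precell -> Prop :=
| DegenBase x j w : j <= dim x -> predegenerate (degen j x, w)
| DegenWord x u (s : letter) j v : j <= dim (val s) ->
    predegenerate (x, u ++ ltr (degen j (val s)) :: v).

Definition cell_degenerate (c : cell) : Prop :=
  exists2 c', predegenerate c' & cls c' = c.

End Necklical.

Local Open Scope ring_scope.

(** * Free modules *)

(* monalg only makes {malg R[K]} an R-module for nontrivial rings R; this alias
   does it for every commutative ring. *)
Definition free (R : comPzRingType) (K : choiceType) : Type := {malg R[K]}.
HB.instance Definition _ (R : comPzRingType) (K : choiceType) :=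
  GRing.Zmodule.on (free R K).

Section Free.
Variables (R : comPzRingType) (K : choiceType).
Implicit Types (c : R) (u v : free R K) (k : K).

Definition free_scale c u : free R K := [malg k in msupp u => c * u@_k].

Lemma free_scaleE c u k : (free_scale c u : {malg R[K]})@_k = c * u@_k.
Proof.
rewrite /free_scale /mcoeff /= fsfunE; case: ifPn => // kNu.
by rewrite [malg_val u k]fsfun_dflt ?mulr0.
Qed.

Fact free_scaleA c c' u : free_scale c (free_scale c' u) = free_scale (c * c') u.
Proof. by apply/malgP => k; rewrite !free_scaleE mulrA. Qed.
Fact free_scale1 : left_id 1 free_scale.
Proof. by move=> u; apply/malgP => k; rewrite free_scaleE mul1r. Qed.
Fact free_scaleDr : right_distributive free_scale +%R.
Proof. by move=> c u v; apply/malgP => k; rewrite mcoeffD !free_scaleE mcoeffD mulrDr. Qed.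
Fact free_scaleDl u : {morph free_scale^~ u : c c' / c + c'}.
Proof. by move=> c c'; apply/malgP => k; rewrite mcoeffD !free_scaleE mulrDl. Qed.

HB.instance Definition _ := GRing.Zmodule_isLmodule.Build R (free R K)
  free_scaleA free_scale1 free_scaleDr free_scaleDl.

Definition gen k : free R K := << (1 : R) *g k >>.

Definition lin_ext (V : lmodType R) (f : K -> V) (u : free R K) : V :=
  \sum_(k <- msupp u) (u : {malg R[K]})@_k *: f k.

Lemma coefZ c u k : (c *: u : {malg R[K]})@_k = c * u@_k.
Proof. exact: free_scaleE. Qed.

Lemma lin_extEw (V : lmodType R) (f : K -> V) u (A : {fset K}) :
  (msupp u `<=` A)%fset ->
  lin_ext f u = \sum_(k <- A) (u : {malg R[K]})@_k *: f k.
Proof.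
move=> le_uA; rewrite /lin_ext (big_fset_incl _ le_uA) // => k _ kNu.
by rewrite (mcoeff_outdom kNu) scale0r.
Qed.

Fact lin_ext_linear (V : lmodType R) (f : K -> V) : linear (lin_ext f).
Proof.
move=> c u v.
pose A := (msupp u `|` msupp v `|` msupp (c *: u + v : {malg R[K]}))%fset.
rewrite !(@lin_extEw V f _ A); last 3 first.
- by rewrite /A fsubsetU // fsubsetUr.
- by rewrite /A fsubsetU // fsubsetUl.
- by rewrite /A fsubsetUr.
rewrite scaler_sumr -big_split; apply: eq_bigr => k _ /=.
by rewrite mcoeffD coefZ scalerDl scalerA.
Qed.

HB.instance Definition _ (V : lmodType R) (f : K -> V) :=
  GRing.isLinear.Build R (free R K) V _ (lin_ext f) (lin_ext_linear f).

Lemma lin_ext_gen (V : lmodType R) (f : K -> V) k : lin_ext f (gen k) = f k.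
Proof.
rewrite (@lin_extEw V f _ [fset k]%fset); last exact: msuppU_le.
by rewrite big_seq_fset1 mcoeffUU scale1r.
Qed.

End Free.

Definition tens (R : comPzRingType) (A B : choiceType)
    (u : free R A) (v : free R B) : free R (A * B)%type :=
  lin_ext (fun a => lin_ext (fun b => gen R (a, b)) v) u.

(* The quotient of the free module on S by the submodule spanned by the subset D
   of S is the free module on the complement of D; [genq s] is the class of s.
   See [redq_surj] and [redq_eq0]. *)
Section Quotient.
Variables (R : comPzRingType) (S : choiceType) (D : S -> Prop).

Definition compl := {s : S | ~~ `[< D s >]}.
HB.instance Definition _ := [isSub of compl for @sval S (fun s => ~~ `[< D s >])].
HB.instance Definition _ := [Choice of compl by <:].

Definition genq (s : S) : free R compl :=
  if insub s is Some t then gen R t else 0.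

Definition redq : free R S -> free R compl := lin_ext genq.

Lemma redq_coef (u : free R S) (t : compl) :
  (redq u : {malg R[compl]})@_t = (u : {malg R[S]})@_(val t).
Proof.
rewrite /redq /lin_ext.
have E (s : S) : (genq s : {malg R[compl]})@_t = (s == val t)%:R.
  rewrite /genq; case: insubP => [t' _ <-|Ds].
    by rewrite /gen mcoeffU -val_eqE.
  rewrite mcoeff0; case: eqP => // Es.
  by move: Ds; rewrite Es (valP t).
rewrite raddf_sum /=.
under eq_bigr => s _ do rewrite coefZ E.
have [tu|tNu] := boolP (val t \in msupp u).
  rewrite (big_fsetD1 _ tu) /= eqxx mulr1 big_seq big1 ?addr0 // => s.
  by rewrite in_fsetD1 => /andP[/negbTE-> _]; rewrite mulr0.
rewrite big_seq big1 ?(mcoeff_outdom tNu) // => s su.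
by case: eqP su tNu => [->->|_ _ _]; rewrite ?mulr0.
Qed.

Lemma redq_surj (v : free R compl) : exists u, redq u = v.
Proof.
exists (\sum_(t <- msupp v) (v : {malg R[compl]})@_t *: gen R (val t)).
rewrite /redq raddf_sum [RHS]monalgE; apply: eq_bigr => t _ /=.
rewrite linearZ /= lin_ext_gen /genq valK.
by apply/malgP => k; rewrite coefZ !mcoeffU; case: eqP; rewrite ?mulr1 ?mulr0.
Qed.

Lemma redq_eq0 (u : free R S) :
  redq u = 0 <-> forall s, s \in msupp u -> D s.
Proof.
split=> [u0 s su|Du].
  case: (asboolP (D s)) => // /asboolPn nDs.
  have := redq_coef u (exist _ s nDs); rewrite u0 mcoeff0 /= => /esym/eqP.
  by rewrite mcoeff_eq0 su.
apply/malgP => t; rewrite redq_coef mcoeff0; apply/eqP; rewrite mcoeff_eq0.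
by apply/negP => /Du /asboolP; apply/negP/(valP t).
Qed.

End Quotient.

(** * Chain complexes and the coHochschild complex *)

(* A complex of free modules with given homogeneous bases; d o d = 0 is not
   part of the data. *)
Record complex (R : comPzRingType) := Complex {
  cbasis : choiceType;
  cdeg : cbasis -> int;
  cdiff : cbasis -> free R cbasis
}.

Definition chains (R : comPzRingType) (A : complex R) := free R (cbasis A).
HB.instance Definition _ (R : comPzRingType) (A : complex R) :=
  GRing.Lmodule.on (chains A).

Definition differential (R : comPzRingType) (A : complex R)
  : chains A -> chains A := lin_ext (@cdiff R A).

Definition homogeneous (R : comPzRingType) (A : complex R) (n : int)
    (u : chains A) : Prop :=
  forall b, b \in msupp u -> cdeg b = n.

Definition chain_iso (R : comPzRingType) (A B : complex R)
    (f : {linear chains A -> chains B}) : Prop :=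
  [/\ bijective f,
      forall n u, homogeneous n u <-> homogeneous n (f u) &
      forall u, f (differential u) = differential (f u)].

(* A coaugmented dg coalgebra, free in each degree, given by a homogeneous basis
   containing the image [gunit] of 1 under the coaugmentation. Coassociativity
   and the other laws are not needed to write down the coHochschild complex. *)
Record coalgebra (R : comPzRingType) := Coalgebra {
  gbasis : choiceType;
  gdeg : gbasis -> nat;
  gdiff : gbasis -> free R gbasis;
  gcoprod : gbasis -> free R (gbasis * gbasis)%type;
  gunit : gbasis
}.
Arguments gunit {R c}.

Section CoHochschild.
Variables (R : comPzRingType) (C : coalgebra R).

(* A basis of coker (k -> C), and the projection C -> coker (k -> C). *)
Definition rbasis := compl (fun c : gbasis C => c = gunit).
HB.instance Definition _ := SubChoice.on rbasis.

Definition bar (c : gbasis C) : free R rbasis :=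
  genq R (fun c : gbasis C => c = gunit) c.

Definition rdeg (c : rbasis) : nat := gdeg (val c).

(* A basis of the cobar construction: c :: w stands for [c|w]. *)
Definition cobasis := seq rbasis.

Definition cobar_letter (c : rbasis) : free R cobasis :=
  - lin_ext (fun b => lin_ext (fun b' => gen R [:: b']) (bar b)) (gdiff (val c))
  + lin_ext (fun p => (-1) ^+ gdeg p.1 *:
      lin_ext (fun q => gen R [:: q.1; q.2]) (tens (bar p.1) (bar p.2)))
      (gcoprod (val c)).

(* The derivation extending cobar_letter. *)
Fixpoint cobar_diff (w : cobasis) : free R cobasis :=
  if w is c :: w' then
    lin_ext (fun z => gen R (z ++ w')) (cobar_letter c)
    + (-1) ^+ (rdeg c).+1 *: lin_ext (fun z => gen R (c :: z)) (cobar_diff w')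
  else 0.

Definition theta1 (v : gbasis C) (w : cobasis) : free R (gbasis C * cobasis)%type :=
  - lin_ext (fun p => (-1) ^+ gdeg p.1 *:
      tens (gen R p.1) (lin_ext (fun c => gen R (c :: w)) (bar p.2)))
      (gcoprod v).

Definition theta2 (v : gbasis C) (w : cobasis) : free R (gbasis C * cobasis)%type :=
  lin_ext (fun p =>
    (-1) ^+ ((gdeg p.1).+1 * (gdeg p.2 + \sum_(c <- w) (rdeg c).+1)) *:
      tens (gen R p.2) (lin_ext (fun c => gen R (rcons w c)) (bar p.1)))
      (gcoprod v).

Definition coHochschild : complex R := {|
  cbasis := (gbasis C * cobasis)%type;
  cdeg := fun b => (gdeg b.1)%:Z + \sum_(c <- b.2) ((rdeg c)%:Z - 1);
  cdiff := fun b =>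
    tens (gdiff b.1) (gen R b.2)
    + (-1) ^+ gdeg b.1 *: tens (gen R b.1) (cobar_diff b.2)
    + theta1 b.1 b.2 + theta2 b.1 b.2
|}.

End CoHochschild.

(** * The two complexes *)

Section Main.
Variables (R : comPzRingType) (X : reduced_sset).

Definition nsimplex := compl (@degenerate X).
HB.instance Definition _ := SubChoice.on nsimplex.

Fact pt_nondegenerate : ~~ `[< degenerate (@pt X) >].
Proof.
apply/asboolP => -[j [y [le_jy pty]]].
by have := dim_degen le_jy; rewrite -pty dim_pt.
Qed.

(* Chains are normalized: degenerate simplices are zero here, and degenerate cells
   are zero in necklical_chains below. The two complexes do not agree otherwise:
   sliding identifies [s_m(s)|t] with [s|s_0(t)], and CellSlide is compatible with
   the differential only modulo degenerate cells, because the summand of d^2 with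
   i = n_0 on the left of CellSlide has no counterpart on the right. *)
Definition simplicial_chains : coalgebra R := {|
  gbasis := nsimplex;
  gdeg := fun x => dim (val x);
  gdiff := fun x =>
    if dim (val x) == 0%N then 0 else
    \sum_(0 <= i < (dim (val x)).+1)
      (-1) ^+ i *: genq R (@degenerate X) (face i (val x));
  gcoprod := fun x =>
    \sum_(0 <= i < (dim (val x)).+1)
      tens (genq R (@degenerate X) (front i (val x)))
           (genq R (@degenerate X) (back i (val x)));
  gunit := exist _ pt pt_nondegenerate
|}.

Definition ncell := compl (@cell_degenerate X).
HB.instance Definition _ := SubChoice.on ncell.

Definition cell_gen (c : precell X) : free R ncell :=
  genq R (@cell_degenerate X) (cls c).

Definition boundary (c : precell X) : free R ncell :=
  \sum_(1 <= i < (predeg c).+1)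
    (-1) ^+ i *: (cell_gen (cface0 i c) - cell_gen (cface1 i c))
  + \sum_(2 <= i < (dim c.1).+1)
    (-1) ^+ (i.-1 * predeg c) *: cell_gen (cface2 i c).

(* All representatives of a nondegenerate cell differ only by occurrences of the
   unit letter, which has no faces and degree 0, so that neither the degree nor the
   differential depends on the representative. *)
Definition necklical_chains : complex R := {|
  cbasis := ncell;
  cdeg := fun c => (cell_deg (val c))%:Z;
  cdiff := fun c => boundary (repr (val c))
|}.

(* The cell corresponding to the tensor of x and [s_1|...|s_k]. *)
Definition cell_of (b : cbasis (coHochschild simplicial_chains)) : precell X :=
  (val b.1, [seq ltr (val (val s)) | s <- b.2]).

End Main.

(* Main.v *)
(* A nondegenerate cell has a unique representative without unit letters, and
   the letters of that representative are exactly the nondegenerate simplices of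
   dimension at least 2, because 1-reducedness makes the unit the only letter of
   dimension 1. These representatives are the basis of the coHochschild complex.
   The differentials then agree face by face: in the interior range [d^0] gives
   the reduced coproduct and [theta_1], [d^2] gives [theta_2] and [d^1] the inner
   faces of simplices, while the splittings that cut off an edge produce the unit
   letter and hence the two missing extreme faces. *)

From Stdlib Require Import Relations.
From mathcomp Require Import all_boot all_algebra finmap generic_quotient boolp.
From mathcomp.multinomials Require Import monalg.
Require Import Defs.

Set Implicit Arguments.
Unset Strict Implicit.
Unset Printing Implicit Defensive.

Import GRing.Theory.

(** * Dimensions of iterated faces *)

Section Faces.
Variable X : sset.
Implicit Type x : X.

(** [foldr] applies the largest index first, so the second bound keeps every index in range as the
    dimension drops. *)
Lemma dim_foldr_face a k x : k <= dim x -> a + k <= (dim x).+1 ->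
  dim (foldr (@face X) x (iota a k)) = dim x - k.
Proof.
elim: k a => [|k IHk] a lek leak /=; first by rewrite subn0.
have IH : dim (foldr (@face X) x (iota a.+1 k)) = dim x - k.
  by apply: IHk; rewrite ?addSnnS // ltnW.
rewrite dim_face IH ?subnS ?subn_gt0 //.
by rewrite leq_subRL ?(ltnW lek) // addnC -ltnS -addnS.
Qed.

Lemma dim_front i x : i <= dim x -> dim (front i x) = i.
Proof.
move=> lei; rewrite dim_foldr_face ?leq_subr ?subKn //.
by rewrite addSn subnKC.
Qed.

Lemma dim_back i x : i <= dim x -> dim (back i x) = dim x - i.
Proof. by move=> lei; rewrite dim_foldr_face // add0n leqW. Qed.

Lemma front_predim x : 0 < dim x -> front (dim x).-1 x = face (dim x) x.
Proof. by move=> x0; rewrite /front -subn1 subKn //= subn1 prednK. Qed.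

End Faces.

(** * Normal forms of cells under deletion of unit letters *)

Section NormalForm.
Variable X : reduced_sset.
Implicit Types (x : X) (s t : letter X) (w u v : word X) (c : precell X).

Lemma val_ltr x : 0 < dim x -> val (ltr x) = x.
Proof. by move=> x0; rewrite /ltr val_insubd x0. Qed.

Lemma ltr_val s : ltr (val s) = s.
Proof. by apply: val_inj; rewrite val_ltr // (valP s). Qed.

Lemma val_unit_letter : val (unit_letter X) = degen 0 pt.
Proof. by []. Qed.

Lemma dim_unit_letter : dim (val (unit_letter X)) = 1.
Proof. by rewrite val_unit_letter dim_degen dim_pt. Qed.

Lemma edge_unit s : dim (val s) = 1 -> s = unit_letter X.
Proof.
by move=> s1; apply: val_inj; rewrite val_unit_letter; apply: edge_uniq.
Qed.

Lemma ltr_edge x : dim x = 1 -> ltr x = unit_letter X.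
Proof. by move=> x1; apply: edge_unit; rewrite val_ltr x1. Qed.

Definition strip w : word X := [seq s <- w | s != unit_letter X].

Lemma strip_cat u v : strip (u ++ v) = strip u ++ strip v.
Proof. exact: filter_cat. Qed.

(** Only units are deleted: slides relate degenerate cells to each other, and these vanish in the
    chains. *)
Definition nf c : precell X := (c.1, strip c.2).

Definition degenerate_letter s :=
  exists t j, j <= dim (val t) /\ s = ltr (degen j (val t)).

Lemma degenerate_letterP s : degenerate_letter s <->
  1 < dim (val s) /\ degenerate (val s).
Proof.
split=> [[t [j [lejt ->]]]|[s1 [j [y [ley sE]]]]].
  rewrite val_ltr dim_degen //; split; first exact: (valP t).
  by exists j, (val t).
have y0 : 0 < dim y by move: s1; rewrite sE dim_degen.
by exists (ltr y), j; rewrite val_ltr // -sE ltr_val.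
Qed.

Lemma predegenerateP c : predegenerate c <->
  degenerate c.1 \/ exists2 s, s \in c.2 & degenerate_letter s.
Proof.
split=> [[x j w le|x u s j v le]|] /=.
- by left; exists j, x.
- right; exists (ltr (degen j (val s))); last by exists s, j.
  by rewrite mem_cat mem_head orbT.
- case: c => x w /= [[j [y [le ->]]]|[s sw [t [j [le sE]]]]].
    exact: DegenBase.
  have /splitPr[u v] := sw; rewrite sE; exact: DegenWord.
Qed.

Lemma unit_nondegenerate : ~ degenerate_letter (unit_letter X).
Proof. by move=> /degenerate_letterP[]; rewrite dim_unit_letter. Qed.

Lemma degenerate_letter_neq_unit s : degenerate_letter s -> s != unit_letter X.
Proof. by move=> d; apply/eqP => sE; apply: unit_nondegenerate; rewrite -sE. Qed.

Lemma predegenerate_nf c : predegenerate (nf c) <-> predegenerate c.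
Proof.
rewrite !predegenerateP /=; split=> -[d|[s + d]]; try by left.
  by rewrite mem_filter => /andP[_ sw]; right; exists s.
by move=> sw; right; exists s; rewrite // mem_filter degenerate_letter_neq_unit.
Qed.

(** The invariant preserved by every generating relation. Normal forms are compared only off the
    degenerate cells because a slide may change them. *)
Definition nf_equiv c c' :=
  (predegenerate c <-> predegenerate c') /\ (~ predegenerate c -> nf c = nf c').

(** Both sides of a slide contain a degenerate letter, so the second half of [nf_equiv] is vacuous;
    deleting a unit leaves the normal form unchanged. *)
Lemma word_step_nf x w w' : word_step w w' -> nf_equiv (x, w) (x, w').
Proof.
case=> [u s t v|u v].
  have d1 : predegenerate (x, u ++ ltr (degen (dim (val s)) (val s)) :: t :: v).
    exact: DegenWord.
  have d2 : predegenerate (x, u ++ s :: ltr (degen 0 (val t)) :: v).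
    by rewrite -cat_rcons; apply: DegenWord.
  by split.
have E : nf (x, u ++ unit_letter X :: v) = nf (x, u ++ v).
  by rewrite /nf /= !strip_cat /strip /= eqxx.
by split=> //; rewrite -predegenerate_nf E predegenerate_nf.
Qed.

Lemma cell_step_nf c c' : cell_step c c' -> nf_equiv c c'.
Proof.
case=> [x w w'|x s w]; first exact: word_step_nf.
have d1 : predegenerate (degen (dim x) x, s :: w) by apply: DegenBase.
have d2 : predegenerate (x, ltr (degen 0 (val s)) :: w).
  by apply: (@DegenWord _ _ [::]).
by split.
Qed.

Lemma cls_eq c c' :
  cls c = cls c' <-> clos_refl_sym_trans _ (@cell_step X) c c'.
Proof.
split=> [/eqmodP/asboolP //|E]; apply/eqmodP; exact/asboolP.
Qed.

(** With [nf_cls], this makes the normal form a complete invariant of nondegenerate classes. *)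
Lemma cls_nf_equiv c c' : cls c = cls c' -> nf_equiv c c'.
Proof.
move=> /cls_eq; elim=> {c c'} [c c' /cell_step_nf //|c //|c c' _|a b c _ + _].
  move=> [E D]; split=> [|nd]; first by rewrite E.
  by rewrite D // E.
move=> [E D] [E' D']; split=> [|nd]; first by rewrite E.
by rewrite D // D' // -E.
Qed.

Lemma cell_degenerateP c : cell_degenerate (cls c) <-> predegenerate c.
Proof. by split=> [[c' d /cls_nf_equiv[<-]]|d] //; exists c. Qed.

Lemma cls_unit x u v : cls (x, u ++ unit_letter X :: v) = cls (x, u ++ v).
Proof. by apply/cls_eq/rst_step/CellWord/WordUnit. Qed.

Lemma cls_strip x w : cls (x, strip w) = cls (x, w).
Proof.
(* The induction carries the prefix [u] already treated, since a unit may occur anywhere in the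
   word. *)
rewrite -[strip w]cat0s -[w in RHS]cat0s; elim: w [::] => //= s w IHw u.
case: eqP => [->|_]; first by rewrite cls_unit IHw.
by rewrite -!cat_rcons IHw.
Qed.

Lemma cls_nf c : cls (nf c) = cls c.
Proof. by case: c => x w; apply: cls_strip. Qed.

Lemma nf_cls c c' : nf c = nf c' -> cls c = cls c'.
Proof. by move=> E; rewrite -[LHS]cls_nf E cls_nf. Qed.

Lemma word_deg_strip w : word_deg (strip w) = word_deg w.
Proof.
rewrite /word_deg; elim: w => //= s w IHw; case: eqP => [->|_] /=.
  by rewrite big_cons dim_unit_letter IHw.
by rewrite !big_cons IHw.
Qed.

Lemma predeg_nf c : predeg (nf c) = predeg c.
Proof. by rewrite /predeg /= word_deg_strip. Qed.

(** A unit letter has no inner vertex, so it uses up no face index, and [0 < j] keeps the index from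
    landing on it. The outer [strip] also removes units that the face creates. *)
Lemma wface0_strip j w : 0 < j ->
  strip (wface0 j (strip w)) = strip (wface0 j w).
Proof.
elim: w j => //= s w IHw j j0; case: eqP => [->|/eqP sU] /=.
  by rewrite dim_unit_letter ltnNge j0 /= eqxx subn0 IHw.
case: ltnP => lej /=; last first.
  by rewrite sU IHw // subn_gt0 prednK ?(valP s).
by rewrite /strip filter_id.
Qed.

Lemma wface1_strip j w : 0 < j ->
  strip (wface1 j (strip w)) = strip (wface1 j w).
Proof.
elim: w j => //= s w IHw j j0; case: eqP => [->|/eqP sU] /=.
  by rewrite dim_unit_letter ltnNge j0 /= eqxx subn0 IHw.
case: ltnP => lej /=; last first.
  by rewrite sU IHw // subn_gt0 prednK ?(valP s).
by rewrite /strip filter_id.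
Qed.

Lemma cface2_nf i c : nf (cface2 i (nf c)) = nf (cface2 i c).
Proof.
case: c => x w.
by rewrite /nf /= -!cats1 !strip_cat /strip filter_id.
Qed.

Lemma cface0_nf i c : nf (cface0 i (nf c)) = nf (cface0 i c).
Proof.
case: c => x w; rewrite /cface0 [nf (x, w)]/nf /=.
case: ltnP => lei; first by rewrite /nf /= wface0_strip // subn_gt0.
by case: eqP => _; rewrite /nf /strip /= filter_id.
Qed.

Lemma cface1_nf i c : nf (cface1 i (nf c)) = nf (cface1 i c).
Proof.
case: c => x w; rewrite /cface1 [nf (x, w)]/nf /=.
case: ltnP => lei; first by rewrite /nf /= wface1_strip // subn_gt0.
case: eqP => _; first exact: (@cface2_nf 1 (x, w)).
by rewrite /nf /strip /= filter_id.
Qed.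

Lemma boundary_nf (R : comPzRingType) c : boundary R (nf c) = boundary R c.
Proof.
rewrite /boundary predeg_nf; congr (_ + _)%R; apply: eq_bigr => i _.
  by rewrite /cell_gen (nf_cls (cface0_nf i c)) (nf_cls (cface1_nf i c)).
by rewrite /cell_gen (nf_cls (cface2_nf i c)).
Qed.

Lemma repr_cls_nf c : ~ predegenerate c -> nf (repr (cls c)) = nf c.
Proof.
move=> nd; have /cls_nf_equiv[E D] : cls c = cls (repr (cls c)).
  by rewrite /cls reprK.
by rewrite D.
Qed.

(** Justifies the use of an arbitrary representative in the differential of [necklical_chains]. *)
Lemma boundary_repr (R : comPzRingType) c : ~ predegenerate c ->
  boundary R (repr (cls c)) = boundary R c.
Proof. by move=> nd; rewrite -boundary_nf repr_cls_nf // boundary_nf. Qed.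

Lemma cell_deg_cls c : ~ predegenerate c -> cell_deg (cls c) = predeg c.
Proof. by move=> nd; rewrite /cell_deg -predeg_nf repr_cls_nf // predeg_nf. Qed.

End NormalForm.

Local Open Scope ring_scope.

(** * Calculus of linear extensions *)

Section LinearExtension.
Variables (R : comPzRingType) (V : lmodType R).

Lemma eq_lin_ext (K : choiceType) (f g : K -> V) (u : free R K) :
  f =1 g -> lin_ext f u = lin_ext g u.
Proof. by move=> fg; apply: eq_bigr => k _; rewrite fg. Qed.

Lemma lin_extZ (K : choiceType) (f : K -> V) a (u : free R K) :
  lin_ext (fun k => a *: f k) u = a *: lin_ext f u.
Proof.
rewrite /lin_ext scaler_sumr; apply: eq_bigr => k _.
by rewrite !scalerA mulrC.
Qed.

Lemma exchange_lin_ext (A B : choiceType) (f : A -> B -> V) (u : free R A)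
    (v : free R B) :
  lin_ext (fun a => lin_ext (f a) v) u =
  lin_ext (fun b => lin_ext (f^~ b) u) v.
Proof.
rewrite /lin_ext; under eq_bigr => a _ do rewrite scaler_sumr.
rewrite exchange_big; apply: eq_bigr => b _; rewrite scaler_sumr.
by apply: eq_bigr => a _; rewrite !scalerA mulrC.
Qed.

Lemma lin_ext_comp (K L : choiceType) (f : L -> V) (g : K -> free R L)
    (u : free R K) :
  lin_ext f (lin_ext g u) = lin_ext (fun k => lin_ext f (g k)) u.
Proof.
rewrite {2}/lin_ext linear_sum; apply: eq_bigr => k _.
by rewrite linearZ.
Qed.

Lemma lin_ext_tens (A B : choiceType) (f : A * B -> V) (u : free R A)
    (v : free R B) :
  lin_ext f (tens u v) = lin_ext (fun a => lin_ext (fun b => f (a, b)) v) u.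
Proof.
rewrite lin_ext_comp; apply: eq_lin_ext => a.
by rewrite lin_ext_comp; apply: eq_lin_ext => b; rewrite lin_ext_gen.
Qed.

Lemma genq_val (S : choiceType) (D : S -> Prop) (t : compl D) :
  genq R D (val t) = gen R t.
Proof. by rewrite /genq valK. Qed.

Lemma genq_eq0 (S : choiceType) (D : S -> Prop) s : D s -> genq R D s = 0.
Proof. by rewrite /genq; case: insubP => // t /asboolP. Qed.

(** Only the generator over [s] can contribute, so facts about [s], such as its dimension, may be
    used. *)
Lemma eq_lin_ext_genq (S : choiceType) (D : S -> Prop) (f g : compl D -> V) s :
  (forall t, val t = s -> f t = g t) ->
  lin_ext f (genq R D s) = lin_ext g (genq R D s).
Proof.
move=> fg; rewrite /genq; case: insubP => [t _ ts|_]; last by rewrite !linear0.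
by rewrite !lin_ext_gen fg.
Qed.

(** A map that vanishes on [D] factors through the quotient by the span of [D]. *)
Lemma lin_ext_genq (S : choiceType) (D : S -> Prop) (f : S -> V) s :
  (D s -> f s = 0) -> lin_ext (fun t => f (val t)) (genq R D s) = f s.
Proof.
move=> f0; rewrite /genq; case: insubP => [t _ <-|].
  by rewrite lin_ext_gen.
by move=> /negbNE/asboolP/f0->; rewrite linear0.
Qed.

End LinearExtension.

(** * Isomorphisms induced by bijections of bases *)

Section BasisBijection.
Variables (R : comPzRingType) (A B : choiceType) (phi : A -> B) (psi : B -> A).
Hypotheses (phiK : cancel phi psi) (psiK : cancel psi phi).

Let f : free R A -> free R B := lin_ext (fun a => gen R (phi a)).
Let g : free R B -> free R A := lin_ext (fun b => gen R (psi b)).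

Lemma lin_ext_id (K : choiceType) (u : free R K) : lin_ext (@gen R K) u = u.
Proof.
apply/malgP => k; rewrite /lin_ext raddf_sum /=.
under eq_bigr => j _ do rewrite coefZ mcoeffU.
have [ku|kNu] := boolP (k \in msupp u).
  rewrite (big_fsetD1 _ ku) /= eqxx mulr1 big_seq big1 ?addr0 // => j.
  by rewrite in_fsetD1 => /andP[/negbTE-> _]; rewrite mulr0.
rewrite big_seq big1 ?(mcoeff_outdom kNu) // => j ju.
by case: eqP ju kNu => [->->|_ _ _]; rewrite ?mulr0.
Qed.

Lemma lin_ext_gen_bij : bijective f.
Proof.
exists g => u; rewrite /f /g lin_ext_comp -[RHS]lin_ext_id;
  by apply: eq_lin_ext => k; rewrite lin_ext_gen ?phiK ?psiK.
Qed.

(** Injectivity of [phi] prevents cancellation. This transports homogeneity. *)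
Lemma msupp_lin_ext_gen u a : (phi a \in msupp (f u)) = (a \in msupp u).
Proof.
suff E : (f u : {malg R[B]})@_(phi a) = (u : {malg R[A]})@_a.
  by apply: negb_inj; rewrite -!mcoeff_eq0 E.
rewrite -[in RHS](lin_ext_id u) /f /lin_ext !raddf_sum.
apply: eq_bigr => b _ /=.
by rewrite !coefZ !mcoeffU (can_eq phiK).
Qed.

End BasisBijection.

(** * Reduced normalized chains and maps defined on words *)

Section WordPart.
Variables (R : comPzRingType) (X : reduced_sset).
Notation C := (simplicial_chains R X).
Implicit Types (x : X) (c : rbasis C) (w : cobasis C).

(** The class of a simplex in the reduced normalized coalgebra: degenerate simplices are killed
    first, then the base point. *)
Definition sbar x : free R (rbasis C) :=
  lin_ext (@bar R C) (genq R (@degenerate X) x).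

Lemma nsimplex_dim (a : nsimplex X) : dim (val a) != 1%N.
Proof.
apply/eqP => /edge_uniq aE; have /asboolP[] := valP a.
by exists 0%N, pt; rewrite leq0n.
Qed.

(** Reduction removes the base point, and the only edge of a 1-reduced set is degenerate. *)
Lemma rdeg_gt1 c : (1 < dim (val (val c)))%N.
Proof.
have c0 : (dim (val (val c)) != 0)%N.
  apply/eqP => /vertex_uniq cpt; have /asboolP[] := valP c.
  exact: val_inj.
by move: c0 (nsimplex_dim (val c)); case: (dim _) => [|[]].
Qed.

Lemma sbar_eq0 x : (dim x <= 1)%N -> sbar x = 0.
Proof.
rewrite leq_eqVlt ltnS leqn0 => /orP[/eqP/edge_uniq->|/eqP/vertex_uniq->].
  rewrite /sbar genq_eq0 ?linear0 //.
  by exists 0%N, pt.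
rewrite /sbar -[pt]/(val (@gunit R C)) genq_val lin_ext_gen.
exact: genq_eq0.
Qed.

Variable V : lmodType R.

(** In dimension at least 2 the simplex is not the base point, so only degeneracy can kill its
    class. *)
Lemma lin_ext_sbar (f : X -> V) x : (1 < dim x)%N ->
  (degenerate x -> f x = 0) ->
  lin_ext (fun c => f (val (val c))) (sbar x) = f x.
Proof.
move=> x1 f0; rewrite lin_ext_comp -[RHS](lin_ext_genq (f := f) f0).
apply: eq_lin_ext_genq => t tx.
apply: (lin_ext_genq (f := fun t : nsimplex X => f (val t))) => tpt.
by move: x1; rewrite -tx tpt /= dim_pt.
Qed.

Definition letter_of c : letter X := ltr (val (val c)).

Lemma val_letter_of c : val (letter_of c) = val (val c).
Proof. by rewrite val_ltr // ltnW // rdeg_gt1. Qed.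

Definition word_of w : word X := [seq letter_of c | c <- w].

(** The properties of [cell_gen] in its word argument on which the cobar comparison rests. Keeping
    [W] general lets an induction absorb the first letter into it. *)
Definition word_functional (W : word X -> V) :=
  (forall u v, W (u ++ unit_letter X :: v) = W (u ++ v)) /\
  (forall u s v, degenerate_letter s -> W (u ++ s :: v) = 0).

Lemma lin_ext_letter W u v x : word_functional W -> (1 < dim x)%N ->
  lin_ext (fun c => W (u ++ letter_of c :: v)) (sbar x) = W (u ++ ltr x :: v).
Proof.
move=> [_ W0] x1.
rewrite (lin_ext_sbar (f := fun x => W (u ++ ltr x :: v))) // => d.
by rewrite W0 //; apply/degenerate_letterP; rewrite val_ltr // ltnW.
Qed.

Lemma word_functional_edge W u v x : word_functional W -> dim x = 1%N ->
  W (u ++ ltr x :: v) = W (u ++ v).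
Proof. by move=> [WU _] x1; rewrite ltr_edge. Qed.

(** The maps [f] and [g] are compared only on pairs of complementary dimensions, so a sign in the
    degrees of the factors becomes a sign in the splitting index [i]. *)
Lemma lin_ext_coprod (f : nsimplex X * nsimplex X -> V)
    (g : nat -> nsimplex X -> nsimplex X -> V) (a : nsimplex X) :
  (forall i s t, dim (val s) = i -> dim (val t) = (dim (val a) - i)%N ->
    f (s, t) = g i s t) ->
  lin_ext f (@gcoprod R C a) =
  \sum_(0 <= i < (dim (val a)).+1)
    lin_ext (fun s => lin_ext (g i s) (genq R (@degenerate X) (back i (val a))))
      (genq R (@degenerate X) (front i (val a))).
Proof.
move=> fg; rewrite linear_sum; apply: eq_big_nat => i /andP[_ lei].
rewrite [LHS]lin_ext_tens.
apply: eq_lin_ext_genq => s si; apply: eq_lin_ext_genq => t ti.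
by apply: fg; rewrite ?si ?ti ?dim_front ?dim_back.
Qed.

Lemma lin_ext_cobar_letter (f : cobasis C -> V) c :
  let x := val (val c) in
  lin_ext f (cobar_letter c) =
  \sum_(0 <= i < (dim x).+1) (-1) ^+ i *:
    lin_ext (fun b => lin_ext (fun b' => f [:: b; b']) (sbar (back i x)))
      (sbar (front i x))
  - \sum_(0 <= i < (dim x).+1) (-1) ^+ i *:
      lin_ext (fun b => f [:: b]) (sbar (face i x)).
Proof.
move=> x; have x1 : (1 < dim x)%N := rdeg_gt1 c.
rewrite /cobar_letter linearD linearN /= addrC -/x; congr (_ - _).
  rewrite lin_ext_comp (@lin_ext_coprod _ (fun i s t => (-1) ^+ i *:
    lin_ext (fun b => lin_ext (fun b' => f [:: b; b']) (@bar R C t))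
      (@bar R C s))); last first.
    move=> i s t si _; rewrite linearZ /= [dim _]si lin_ext_comp lin_ext_tens.
    congr (_ *: _); apply: eq_lin_ext => b; apply: eq_lin_ext => b'.
    exact: lin_ext_gen.
  apply: eq_bigr => i _; rewrite -lin_extZ [RHS]lin_ext_comp.
  apply: eq_lin_ext => s; rewrite !lin_extZ exchange_lin_ext; congr (_ *: _).
  by apply: eq_lin_ext => b; rewrite lin_ext_comp.
rewrite lin_ext_comp ifN -?lt0n 1?ltnW // linear_sum.
apply: eq_bigr => i _; rewrite linearZ lin_ext_comp; congr (_ *: _).
apply: eq_lin_ext => b; rewrite lin_ext_comp; apply: eq_lin_ext => b'.
by rewrite lin_ext_gen.
Qed.

End WordPart.

(** * The cobar differential as faces of words *)

Section WordBoundary.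
Variables (R : comPzRingType) (X : reduced_sset) (V : lmodType R).
Notation C := (simplicial_chains R X).
Implicit Types (x : X) (c : rbasis C) (w : cobasis C) (W : word X -> V).

Lemma word_functional_cons W s : word_functional W ->
  word_functional (fun z => W (s :: z)).
Proof.
by move=> [WU W0]; split=> [u v|u t v d]; rewrite -!cat_cons ?WU ?W0.
Qed.

Lemma lin_ext_letter2 W v x y : word_functional W ->
  (1 < dim x)%N -> (1 < dim y)%N ->
  lin_ext (fun c => lin_ext (fun c' => W (letter_of c :: letter_of c' :: v))
    (sbar R y)) (sbar R x) = W (ltr x :: ltr y :: v).
Proof.
move=> HW x1 y1; rewrite -(lin_ext_letter [::] _ HW x1).
apply: eq_lin_ext => c; exact: (lin_ext_letter [:: letter_of c] _ HW y1).
Qed.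

(* A front or back edge is the unit letter on the necklical side but 0 on the
   cobar side: these terms account for the two extreme faces of [x], which
   occur only in the differential of the cobar construction. *)
Lemma letter_boundary W v x : word_functional W -> (1 < dim x)%N ->
  \sum_(1 <= l < dim x) (-1) ^+ l *:
    (W (ltr (front l x) :: ltr (back l x) :: v) - W (ltr (face l x) :: v)) =
  \sum_(0 <= l < (dim x).+1) (-1) ^+ l *:
    lin_ext (fun c => lin_ext (fun c' => W (letter_of c :: letter_of c' :: v))
      (sbar R (back l x))) (sbar R (front l x))
  - \sum_(0 <= l < (dim x).+1) (-1) ^+ l *:
      lin_ext (fun c => W (letter_of c :: v)) (sbar R (face l x)).
Proof.
move=> HW x1; pose T2 l := (-1) ^+ l *:
  lin_ext (fun c => lin_ext (fun c' => W (letter_of c :: letter_of c' :: v))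
    (sbar R (back l x))) (sbar R (front l x)).
pose T1 l := (-1) ^+ l *:
  lin_ext (fun c => W (letter_of c :: v)) (sbar R (face l x)).
rewrite -[RHS]/(\sum_(0 <= l < (dim x).+1) T2 l
  - \sum_(0 <= l < (dim x).+1) T1 l).
have T2_front l : (l <= dim x)%N -> (l <= 1)%N -> T2 l = 0.
  move=> lex le1; rewrite /T2 (@sbar_eq0 _ _ (front _ _)) ?dim_front //.
  by rewrite linear0 scaler0.
have T2_back l : (l <= dim x)%N -> (dim x <= l.+1)%N -> T2 l = 0.
  move=> lex le1; rewrite /T2 (@sbar_eq0 _ _ (back _ _)); last first.
    by rewrite dim_back // leq_subLR addn1.
  rewrite /lin_ext big1 ?scaler0 // => b _.
  by rewrite -/(lin_ext _ _) linear0 scaler0.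
(* In dimension 2 the only inner splitting has two edges and all faces are edges, so both sides
   vanish. *)
have [x2|x2] := leqP (dim x) 2.
  have {x1 x2} x2 : dim x = 2 by apply/eqP; rewrite eqn_leq x2.
  rewrite x2 in T2_front T2_back *.
  rewrite big_nat1 !big_nat_recr //= !big_nil.
  rewrite (T2_front 0%N) // (T2_front 1%N) // (T2_back 2) //.
  rewrite /T1 !sbar_eq0 ?dim_face ?x2 //.
  rewrite !linear0 !(addr0, subr0).
  rewrite (word_functional_edge [::] _ HW) ?dim_front ?x2 //.
  rewrite (word_functional_edge [::] _ HW) ?dim_back ?x2 //.
  by rewrite (word_functional_edge [::] _ HW) ?dim_face ?x2 //= subrr scaler0.
have HT1 l : (l <= dim x)%N -> T1 l = (-1) ^+ l *: W (ltr (face l x) :: v).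
  move=> lex; rewrite /T1 (lin_ext_letter [::] _ HW) //.
  by rewrite dim_face // ?(ltnW x1) // -ltnS prednK // ltnW.
have HT2 l : (1 < l)%N -> (l.+1 < dim x)%N ->
    T2 l = (-1) ^+ l *: W (ltr (front l x) :: ltr (back l x) :: v).
  move=> l1 lx; have lex : (l <= dim x)%N by rewrite ltnW // ltnW.
  by rewrite /T2 lin_ext_letter2 ?dim_front ?dim_back // ltn_subRL addn1.
(* From dimension 3 on, the splitting indices 0, 1, [p.+2] and [p.+3] are distinct; their cobar
   terms vanish and are peeled off. *)
have [p xp] : exists p, dim x = p.+3.
  by case: (dim x) x2 => [|[|[|p]]] // _; exists p.
rewrite xp in HT1 HT2 T2_front T2_back *.
rewrite [X in _ = X - _]big_ltn // [X in _ = _ + X - _]big_ltn //.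
rewrite [X in _ = X - _]addrA [X in _ = _ + X - _]big_nat_recr //=.
rewrite [X in _ = _ + (X + _) - _]big_nat_recr //=.
rewrite (T2_front 0%N) // (T2_front 1%N) // (T2_back p.+2) //.
rewrite (T2_back p.+3) // !(add0r, addr0).
rewrite [X in _ = _ - X]big_ltn // [X in _ = _ - (_ + X)]big_nat_recr //=.
under [X in X = _]eq_bigr => l _ do rewrite scalerBr.
rewrite sumrB opprD opprD [X in X - _ = _]big_ltn //.
rewrite [X in _ + X - _ = _]big_nat_recr //=.
under [X in _ + (X + _) - _]eq_big_nat => l /andP[l1 lp] do rewrite -HT2 //.
under [X in _ - X]eq_big_nat => l /andP[l1 lp] do rewrite -HT1 1?ltnW //.
(* The front edge drops out and [back 1 x] is face 0, with sign opposite to that in [T1]; the last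
   inner index likewise yields the last face. *)
have -> : (-1) ^+ 1 *: W [:: ltr (front 1 x), ltr (back 1 x) & v] = - T1 0%N.
  rewrite (word_functional_edge [::] _ HW) ?dim_front ?xp // HT1 //.
  by rewrite expr1 expr0 scaleN1r scale1r.
have -> : (-1) ^+ p.+2 *: W [:: ltr (front p.+2 x), ltr (back p.+2 x) & v] =
    - T1 p.+3.
  rewrite (word_functional_edge [:: _] _ HW) ?dim_back ?xp ?subSnn // HT1 //.
  by rewrite -[p.+2]/(p.+3.-1) -{1 2}xp front_predim ?xp // exprS mulN1r
    scaleNr opprK.
by rewrite -!addrA [- T1 p.+3 + _]addrC addrCA.
Qed.

(** Faces of index below the dimension [m] of the first letter act on it; the others act on the tail
    with index shifted by [m.-1]. The resulting sign [(-1) ^+ m.-1] is the Koszul sign of the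
    desuspended letter. *)
Lemma word_boundary W w : word_functional W ->
  \sum_(1 <= j < (word_deg (word_of w)).+1) (-1) ^+ j *:
    (W (wface0 j (word_of w)) - W (wface1 j (word_of w))) =
  lin_ext (fun z => W (word_of z)) (cobar_diff w).
Proof.
elim: w W => [|c w IHw] W HW.
  by rewrite /word_deg big_nil big_geq // linear0.
have c1 := rdeg_gt1 c; set m := dim (val (val c)) in c1.
have m1 : (m = m.-1.+1)%N by rewrite prednK // ltnW.
have -> : (word_deg (word_of (c :: w)) = m.-1 + word_deg (word_of w))%N.
  by rewrite /word_deg big_cons val_letter_of.
rewrite (big_cat_nat (n := m)) /=;
  [|exact: ltnW|by rewrite {1}m1 ltnS leq_addr].
rewrite linearD; congr (_ + _); rewrite [RHS]/=.
  rewrite lin_ext_comp lin_ext_cobar_letter.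
  transitivity (\sum_(1 <= l < m) (-1) ^+ l *:
    (W (ltr (front l (val (val c))) :: ltr (back l (val (val c))) :: word_of w)
      - W (ltr (face l (val (val c))) :: word_of w))).
    by apply: eq_big_nat => l /andP[_ lm]; rewrite val_letter_of lm.
  rewrite letter_boundary //.
  congr (_ - _); apply: eq_bigr => l _; congr (_ *: _).
    by apply: eq_lin_ext => b; apply: eq_lin_ext => b'; rewrite lin_ext_gen.
  by apply: eq_lin_ext => b; rewrite lin_ext_gen.
rewrite linearZ /= lin_ext_comp.
transitivity ((-1) ^+ m.+1 *:
  lin_ext (fun z => W (letter_of c :: word_of z)) (cobar_diff w)); last first.
  by congr (_ *: _); apply: eq_lin_ext => z; rewrite lin_ext_gen.
rewrite -(IHw _ (word_functional_cons (letter_of c) HW)) scaler_sumr.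
rewrite -addnS addnC [in LHS]m1 -add1n big_addn addnK.
apply: eq_big_nat => j /andP[j0 _].
rewrite scalerA -exprD /= val_letter_of -/m ltnNge.
have -> /= : (m <= j + m.-1)%N by rewrite {1}m1 -add1n leq_add2r.
by rewrite addnK [in RHS]m1 !addSn !exprS !mulN1r opprK addnC.
Qed.
End WordBoundary.

(** * Comparison of the differentials on a generator *)

Section CellBoundary.
Variables (R : comPzRingType) (X : reduced_sset).
Notation C := (simplicial_chains R X).
Implicit Types (x : X) (v : word X) (a : nsimplex X) (w : cobasis C).

Lemma cell_gen_eq0 (c : precell X) : predegenerate c -> cell_gen R c = 0.
Proof. by move=> d; apply/genq_eq0/cell_degenerateP. Qed.

Lemma cell_gen_functional x : word_functional (fun v => cell_gen R (x, v)).
Proof.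
split=> [u v|u s v d]; first by rewrite /cell_gen cls_unit.
apply/cell_gen_eq0/predegenerateP; right; exists s => //.
by rewrite mem_cat mem_head orbT.
Qed.

Lemma lin_ext_cell_gen x v :
  lin_ext (fun a => cell_gen R (val a, v)) (genq R (@degenerate X) x) =
  cell_gen R (x, v).
Proof.
apply: (lin_ext_genq (f := fun x => cell_gen R (x, v))) => d.
by apply/cell_gen_eq0/predegenerateP; left.
Qed.

(** With [p = i.-1], a splitting at vertex [p] is a term of [theta1], except at [p = (dim x).-1]:
    there the back edge is the unit letter, leaving the last face of [x], while [sbar] of it is
    0. *)
Lemma base_faces0 x v : (1 < dim x)%N ->
  \sum_(1 <= i < (dim x).+1) (-1) ^+ i *: cell_gen R (cface0 i (x, v)) =
  (-1) ^+ dim x *: cell_gen R (face (dim x) x, v)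
  - \sum_(0 <= p < (dim x).+1) (-1) ^+ p *:
      lin_ext (fun c => cell_gen R (front p x, letter_of c :: v))
        (sbar R (back p x)).
Proof.
move=> x1; have HW := cell_gen_functional.
have [p xp] : exists p, dim x = p.+2.
  by case: (dim x) x1 => [|[|p]] // _; exists p.
rewrite big_add1 /= [X in _ = _ - X]big_nat_recr //= sbar_eq0; last first.
  by rewrite dim_back // subnn.
rewrite linear0 scaler0 addr0 xp big_nat_recr //=.
rewrite [X in _ = _ - X]big_nat_recr //= sbar_eq0; last first.
  by rewrite dim_back xp // subSnn.
rewrite linear0 scaler0 addr0 ltnn addrC; congr (_ + _).
  congr (_ *: _); rewrite (word_functional_edge [::] _ (HW _)) /=.
    by rewrite -{1}[p.+1]/(p.+2.-1) -xp front_predim ?xp.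
  by rewrite dim_back xp // subSnn.
rewrite -sumrN; apply: eq_big_nat => i /andP[_ lei].
have leix : (i < p.+2)%N by rewrite ltnW.
rewrite (lin_ext_letter [::] _ (HW _)); last first.
  by rewrite dim_back xp ?(ltnW leix) // ltn_subRL addn1.
rewrite exprS mulN1r scaleNr ltnS ltnNge -ltnS leix /=.
(* The first face is written with [pt] and [x] themselves: [front 0 x] is the only vertex and
   [back 0 x] computes to [x]. *)
case: i lei leix => [|i] //= _ _.
by rewrite (vertex_uniq (x := front 0 x)) // dim_front.
Qed.

(** The face of index 1 is [cface2 1], whose front edge is the unit letter, so it gives face 0 of
    [x]. The last face is supplied by [base_faces0]. *)
Lemma base_faces1 x v : (1 < dim x)%N ->
  \sum_(1 <= i < (dim x).+1) (-1) ^+ i *: cell_gen R (cface1 i (x, v)) =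
  - \sum_(0 <= p < dim x) (-1) ^+ p *: cell_gen R (face p x, v).
Proof.
move=> x1; rewrite big_add1 -sumrN /=; apply: eq_big_nat => i /andP[_ leix].
rewrite exprS mulN1r scaleNr; congr (- (_ *: _)); rewrite ltnNge leix /=.
case: i leix => [|i] //= _; rewrite -cats1.
rewrite (word_functional_edge v [::] (cell_gen_functional _)) ?cats0 //.
by rewrite dim_front // ltnW.
Qed.

(** Fronts of dimension at most 1 vanish in the reduced coalgebra, which matches the sum of [d^2]
    starting at 2. *)
Lemma base_faces2 x v n e : (1 < dim x)%N -> odd n = odd (dim x + e) ->
  \sum_(2 <= i < (dim x).+1)
    (-1) ^+ (i.-1 * n) *: cell_gen R (cface2 i (x, v)) =
  \sum_(0 <= p < (dim x).+1) (-1) ^+ (p.+1 * (dim x - p + e)) *: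
    lin_ext (fun c => cell_gen R (back p x, rcons v (letter_of c)))
      (sbar R (front p x)).
Proof.
move=> x1 ne.
rewrite [RHS]big_ltn // sbar_eq0 ?dim_front // linear0 scaler0 add0r.
rewrite [RHS]big_ltn; last by rewrite ltnS ltnW.
rewrite sbar_eq0 ?dim_front ?(ltnW x1) // linear0 scaler0 add0r.
apply: eq_big_nat => i /andP[i1]; rewrite ltnS => leix; congr (_ *: _).
  (* For odd [i] both exponents are even; for even [i] they have the parities of [n] and
     [dim x + e]. *)
  rewrite -signr_odd -[RHS]signr_odd; congr (_ ^+ nat_of_bool _).
  rewrite !oddM ne !oddD oddB //=.
  case: i i1 {leix} => //= i _; rewrite negbK.
  by case: (odd i); case: (odd (dim x)); case: (odd e).
rewrite /= -cats1.
rewrite -(lin_ext_letter v [::] (cell_gen_functional _)) ?dim_front //.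
by apply: eq_lin_ext => c; rewrite cats1.
Qed.

Let F (b : cbasis (coHochschild C)) := cell_gen R (cell_of b).

Lemma lin_ext_theta1 a w :
  lin_ext F (@theta1 R C a w) =
  - \sum_(0 <= p < (dim (val a)).+1) (-1) ^+ p *:
      lin_ext (fun c => cell_gen R (front p (val a), letter_of c :: word_of w))
        (sbar R (back p (val a))).
Proof.
rewrite linearN /= lin_ext_comp; congr (- _).
rewrite (@lin_ext_coprod _ _ _ _ (fun i s t => (-1) ^+ i *:
  lin_ext (fun c => F (s, c :: w)) (@bar R C t))); last first.
  move=> i s t si _; rewrite linearZ /= [dim _]si lin_ext_tens lin_ext_gen.
  rewrite lin_ext_comp; congr (_ *: _).
  by apply: eq_lin_ext => c; rewrite lin_ext_gen.
apply: eq_bigr => i _.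
under eq_lin_ext => s do rewrite lin_extZ -lin_ext_comp.
rewrite lin_extZ exchange_lin_ext; congr (_ *: _); apply: eq_lin_ext => c.
exact: lin_ext_cell_gen.
Qed.

Lemma lin_ext_theta2 a w :
  lin_ext F (@theta2 R C a w) =
  \sum_(0 <= p < (dim (val a)).+1)
    (-1) ^+ (p.+1 * (dim (val a) - p + \sum_(c <- w) (rdeg c).+1)) *:
      lin_ext (fun c =>
          cell_gen R (back p (val a), rcons (word_of w) (letter_of c)))
        (sbar R (front p (val a))).
Proof.
rewrite lin_ext_comp.
rewrite (@lin_ext_coprod _ _ _ _ (fun i s t => (-1) ^+
    (i.+1 * (dim (val a) - i + \sum_(c <- w) (rdeg c).+1)) *:
  lin_ext (fun c => F (t, rcons w c)) (@bar R C s))); last first.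
  move=> i s t si ti; rewrite linearZ /= [dim _]si [dim (sval t)]ti.
  rewrite lin_ext_tens lin_ext_gen lin_ext_comp; congr (_ *: _).
  by apply: eq_lin_ext => c; rewrite lin_ext_gen.
apply: eq_bigr => i _.
under eq_lin_ext => s do rewrite lin_extZ exchange_lin_ext.
rewrite lin_extZ -lin_ext_comp; congr (_ *: _); apply: eq_lin_ext => c.
rewrite -lin_ext_cell_gen; apply: eq_lin_ext => t.
by rewrite /F /cell_of /= map_rcons.
Qed.

(** Desuspension lowers the degree by 1 while the signs of [theta2] raise it by 1, with the same
    parity in positive dimension. *)
Lemma odd_word_deg w :
  odd (word_deg (word_of w)) = odd (\sum_(c <- w) (rdeg c).+1).
Proof.
elim: w => [|c w IHw]; first by rewrite /word_deg !big_nil.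
rewrite /word_deg /= !big_cons !oddD val_letter_of.
rewrite -[\sum_(s <- _) _]/(word_deg (word_of w)) IHw; congr (_ (+) _).
by have := rdeg_gt1 c; rewrite /rdeg /=; case: (dim _) => //= n; rewrite negbK.
Qed.

(** The index shift by [dim x] contributes the sign of moving the cobar differential past [x]. *)
Lemma word_faces x v :
  \sum_((dim x).+1 <= i < (predeg (x, v)).+1) (-1) ^+ i *:
    (cell_gen R (cface0 i (x, v)) - cell_gen R (cface1 i (x, v))) =
  (-1) ^+ dim x *: \sum_(1 <= j < (word_deg v).+1) (-1) ^+ j *:
    (cell_gen R (x, wface0 j v) - cell_gen R (x, wface1 j v)).
Proof.
rewrite /predeg -addnS addnC -[X in \sum_(X <= _ < _) _]add1n big_addn addnK.
rewrite scaler_sumr; apply: eq_big_nat => j /andP[j0 _].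
by rewrite scalerA -exprD addnC /= -ltn_subLR // subnn j0 addKn.
Qed.

Lemma boundary_cell_of a w :
  lin_ext F (@cdiff R (coHochschild C) (a, w)) = boundary R (val a, word_of w).
Proof.
set x := val a; set v := word_of w.
rewrite /= !linearD /= lin_ext_theta1 lin_ext_theta2 lin_ext_tens linearZ /=.
rewrite lin_ext_tens lin_ext_gen -/x -/v.
have -> : lin_ext (fun z => F (a, z)) (cobar_diff w) =
  \sum_(1 <= j < (word_deg v).+1) (-1) ^+ j *:
    (cell_gen R (x, wface0 j v) - cell_gen R (x, wface1 j v)).
  by rewrite (word_boundary w (cell_gen_functional x)).
rewrite -word_faces /boundary.
rewrite [X in _ = X + _](big_cat_nat (n := (dim x).+1)) //;
  last exact: leq_addr.
have -> : lin_ext (fun s => lin_ext (fun t => F (s, t)) (gen R w))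
    (@gdiff R C a) =
  if dim x == 0%N then 0 else
  \sum_(0 <= i < (dim x).+1) (-1) ^+ i *: cell_gen R (face i x, v).
  rewrite /= -/x; case: eqP => _; first exact: linear0.
  rewrite linear_sum; apply: eq_bigr => i _; rewrite linearZ -lin_ext_cell_gen.
  congr (_ *: _); apply: eq_lin_ext => s; exact: lin_ext_gen.
(* A vertex has no base faces, and both theta terms involve the reduced class of a vertex, which is
   0. Dimension 1 is excluded by nondegeneracy. *)
have [x0|x0] := eqVneq (dim x) 0%N.
  rewrite x0 !big_nat1 (vertex_uniq (x := front 0 x)) ?dim_front //.
  rewrite (@sbar_eq0 R _ (back 0 x)) ?x0 // sbar_eq0 ?dim_pt // !linear0.
  rewrite ?scaler0 ?oppr0 ?subr0 !addr0 [X in _ = X + _ + _]big_geq //.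
  by rewrite [X in _ = _ + X]big_geq // addr0.
have x1 : (1 < dim x)%N.
  by move: x0 (nsimplex_dim a); rewrite -/x; case: (dim x) => [|[]].
rewrite (base_faces2 _ (e := \sum_(c <- w) (rdeg c).+1)) //; last first.
  by rewrite /predeg !oddD odd_word_deg.
under [X in _ = X + _ + _]eq_bigr => i _ do rewrite scalerBr.
rewrite sumrB base_faces0 // base_faces1 // opprK.
rewrite [X in X + _ + _ + _ = _]big_nat_recr //.
congr (_ + _).
have rot (V : zmodType) (s d m u : V) : s + d + m - u = d - u + s + m.
  by rewrite [d - u + s]addrC addrA [RHS]addrAC.
exact: rot.
Qed.

End CellBoundary.

(** * The bijection of bases and the chain isomorphism *)

Section Main.
Variables (R : comPzRingType) (X : reduced_sset).
Notation C := (simplicial_chains R X).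
Implicit Types (b : cbasis (coHochschild C)).

Lemma cell_of_nondegenerate b : ~ predegenerate (cell_of b).
Proof.
case: b => a w /predegenerateP[|[s /mapP[c _ ->] /degenerate_letterP[_]]] /=.
  by have /asboolP := valP a.
by rewrite val_letter_of => d; have /asboolP[] := valP (val c).
Qed.

Lemma cell_of_strip b : nf (cell_of b) = cell_of b.
Proof.
case: b => a w; rewrite /nf /cell_of /=; congr (_, _).
apply/all_filterP/allP => s /mapP[c _ ->]; apply/eqP => cE.
have := rdeg_gt1 (c : rbasis C).
by rewrite -(val_letter_of (c : rbasis C)) [letter_of _]cE dim_unit_letter.
Qed.

Lemma cls_cell_of_nondegenerate b : ~~ `[< cell_degenerate (cls (cell_of b)) >].
Proof. by apply/asboolP => /cell_degenerateP/cell_of_nondegenerate. Qed.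

Definition ncell_of b : ncell X := 
  exist _ (cls (cell_of b)) (cls_cell_of_nondegenerate b).

Lemma cell_gen_cell_of b : cell_gen R (cell_of b) = gen R (ncell_of b).
Proof. exact: (genq_val _ (ncell_of b)). Qed.

Lemma word_of_inj : injective (@word_of R X).
Proof.
apply: inj_map => c c' /(congr1 val); rewrite !val_letter_of.
by move=> /val_inj/val_inj.
Qed.

(** Both representatives are their own normal forms, and these are invariants of nondegenerate
    classes. *)
Lemma ncell_of_inj : injective ncell_of.
Proof.
move=> b b' /(congr1 val)/= /cls_nf_equiv[_ /(_ (@cell_of_nondegenerate b))].
rewrite !cell_of_strip; case: b b' => [a w] [a' w'] [/val_inj-> ww'].
by congr (_, _); apply: word_of_inj.
Qed.

(** A letter that survives [strip] has dimension at least 2, since an edge is the unit; being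
    nondegenerate, it is a basis element of the reduced coalgebra. *)
Lemma nondegenerate_word_of (v : word X) :
  {in v, forall s, ~ degenerate_letter s} ->
  exists w : cobasis C, word_of w = strip v.
Proof.
elim: v => [|s v IHv] nd; first by exists [::].
have [|w wv] := IHv; first by move=> t tv; apply: nd; rewrite in_cons tv orbT.
rewrite /=; case: eqP => [_|sU] /=; first by exists w.
have s1 : (1 < dim (val s))%N.
  rewrite ltn_neqAle (valP s) andbT; apply/eqP => /esym s1; exact/sU/edge_unit.
have nds : ~~ `[< degenerate (val s) >].
  apply/asboolP => d; apply: (nd s); rewrite ?mem_head //.
  exact/degenerate_letterP.
pose t : nsimplex X := exist _ (val s) nds.
have nt : ~~ `[< t = @gunit R C >].
  apply/asboolP => /(congr1 val) sE; move: s1.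
  by rewrite -[val s]/(val t) sE dim_pt.
exists ((exist _ t nt : rbasis C) :: w).
by rewrite /= wv /letter_of /= ltr_val.
Qed.

(** Any representative of a nondegenerate cell has nondegenerate base and letters, so stripping its
    units puts it in the image. *)
Lemma ncell_of_surj (c : ncell X) : exists b, ncell_of b = c.
Proof.
case E : (repr (val c)) => [x v].
have clsE : cls (x, v) = val c by rewrite -E /cls reprK.
have nd : ~ predegenerate (x, v).
  by rewrite -cell_degenerateP clsE; have /asboolP := valP c.
have ndx : ~~ `[< degenerate x >].
  by apply/asboolP => d; apply/nd/predegenerateP; left.
have [|w wv] := @nondegenerate_word_of v.
  by move=> s sv d; apply/nd/predegenerateP; right; exists s.
exists (exist _ x ndx : nsimplex X, w); apply: val_inj => /=.
rewrite -clsE -[RHS]cls_strip -wv; reflexivity.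
Qed.

End Main.

Theorem theorem4 (k : comPzRingType) (X : reduced_sset) :
  exists f : {linear chains (coHochschild (simplicial_chains k X))
                     -> chains (necklical_chains k X)},
    chain_iso f /\
    forall b : cbasis (coHochschild (simplicial_chains k X)),
      f (gen k b) = cell_gen k (cell_of b).
Proof.
have [psi psiK] := choice (@ncell_of_surj k X).
have phiK : cancel (@ncell_of k X) psi.
  by move=> b; apply: ncell_of_inj; rewrite psiK.
pose f : {linear chains (coHochschild (simplicial_chains k X))
                     -> chains (necklical_chains k X)} :=
  lin_ext (fun b => gen k (ncell_of b)).
exists f; split; last first.
  by move=> b; rewrite cell_gen_cell_of; apply: lin_ext_gen.
have degE b : cdeg (ncell_of b : cbasis (necklical_chains k X)) = cdeg b.
  rewrite /= cell_deg_cls; last exact: cell_of_nondegenerate.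
  case: b => a w; rewrite /predeg PoszD; congr (_ + _).
  rewrite /word_deg big_map (big_morph Posz PoszD (erefl _)).
  (* All letters have dimension above 1, so the truncated predecessor agrees with the integer
     degree. *)
  by apply: eq_bigr => c _; rewrite val_letter_of predn_int // ltnW // rdeg_gt1.
split; first exact: lin_ext_gen_bij phiK psiK.
- move=> n u; split=> hu c cu.
    rewrite -(psiK c) degE; apply: hu.
    by rewrite -(msupp_lin_ext_gen phiK) psiK.
  by rewrite -degE; apply: hu; rewrite (msupp_lin_ext_gen phiK).
move=> u; rewrite /f /= /differential !lin_ext_comp; apply: eq_lin_ext => -[a w].
rewrite lin_ext_gen /= boundary_repr; last exact: cell_of_nondegenerate.
rewrite -boundary_cell_of; apply: eq_lin_ext => b; exact/esym/cell_gen_cell_of.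
Qed.
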